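(* Let $G$ be a connected graph of order $n$. (1) If $n\geq 3$ and $\gamma_{[1,2]}(G)>\frac{4n}{5}$, then $\gamma_{t[1,2]}(G)=+\infty$. (2) If $n\geq 5$, $\delta(G)\geq 2$ and $\gamma_{[1,2]}(G)>\frac{2n}{3}$, then $\gamma_{t[1,2]}(G)=+\infty$. (3) Let $G$ be a tree of order $n$ with $k$ leaves. If $\gamma_{[1,2]}(G)=n-k$, then $\gamma_{t[1,2]}(G)=+\infty$ unless $G$ is a caterpillar.
   Context: All graphs are finite, simple and undirected; $N(v)$ denotes the neighborhood of $v$ and $\delta(G)$ the minimum degree. A set $S\subseteq V(G)$ is a $[1,2]$-set of $G$ if $1\leq |N(v)\cap S|\leq 2$ for every vertex $v\in V(G)\setminus S$; $\gamma_{[1,2]}(G)$ is the minimum cardinality of a $[1,2]$-set. A set $S\subseteq V(G)$ is a total $[1,2]$-set of $G$ if $1\leq |N(v)\cap S|\leq 2$ for every vertex $v\in V(G)$; $\gamma_{t[1,2]}(G)$ is the minimum cardinality of a total $[1,2]$-set, with $\gamma_{t[1,2]}(G)=+\infty$ if no such set exists. A leaf is a vertex of degree 1. A caterpillar is a tree in which deleting all leaves leaves a path. *)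

(* Defs.v *)
From HB Require Import structures.
From mathcomp Require Import all_boot all_order all_algebra.

Set Implicit Arguments.
Unset Strict Implicit.
Unset Printing Implicit Defensive.

(* A finite simple graph is a symmetric irreflexive relation e on a finType T. *)

Definition nbhd (T : finType) (e : rel T) (v : T) : {set T} := [set u | e v u].

Definition degree (T : finType) (e : rel T) (v : T) : nat := #|nbhd e v|.

(* Every degree of a simple graph is at most #|T|, so the default value #|T|  *)
(* plays no role as soon as T is nonempty.                                    *)
Definition min_degree (T : finType) (e : rel T) : nat :=
  \big[minn/#|T|]_(v : T) degree e v.

(* The null graph is not connected; in particular trees are nonempty.         *)
Definition is_connected (T : finType) (e : rel T) : Prop :=
  0 < #|T| /\ forall u v : T, connect e u v.

Definition is_acyclic (T : finType) (e : rel T) : Prop :=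
  forall c : seq T, ucycle e c -> size c < 3.

Definition is_tree (T : finType) (e : rel T) : Prop :=
  is_connected e /\ is_acyclic e.

Definition leaves (T : finType) (e : rel T) : {set T} :=
  [set v | degree e v == 1].

(* The subgraph induced by A is isomorphic to the path 0 - 1 - ... - m.-1.    *)
(* The case m = 0 is allowed, so that the one-edge tree is a caterpillar.     *)
Definition induces_path (T : finType) (e : rel T) (A : {set T}) : Prop :=
  exists (m : nat) (f : 'I_m -> T),
    [/\ injective f,
        forall v : T, v \in A <-> exists i : 'I_m, f i = v &
        forall i j : 'I_m, e (f i) (f j) = (i.+1 == j) || (j.+1 == i)].

Definition is_caterpillar (T : finType) (e : rel T) : Prop :=
  is_tree e /\ induces_path e (~: leaves e).

Definition is_12set (T : finType) (e : rel T) (S : {set T}) : bool :=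
  [forall v in ~: S, 1 <= #|nbhd e v :&: S| <= 2].

Definition is_total_12set (T : finType) (e : rel T) (S : {set T}) : bool :=
  [forall v, 1 <= #|nbhd e v :&: S| <= 2].

(* The whole vertex set is always a [1,2]-set, so this minimum is attained.   *)
Definition gamma12 (T : finType) (e : rel T) : nat :=
  #|[arg min_(S < [set: T] | is_12set e S) #|S|]|.

Lemma is_12setT (T : finType) (e : rel T) : is_12set e [set: T].
Proof. by apply/forallP => v; rewrite setCT in_set0. Qed.

(* None stands for +oo.                                                       *)
Definition gamma_t12 (T : finType) (e : rel T) : option nat :=
  if [pick S | is_total_12set e S] is Some S0
  then Some #|[arg min_(S < S0 | is_total_12set e S) #|S|]|
  else None.

(* Main.v *)
(** Let [D] be a total [1,2]-set.  Every vertex has at most two neighbours in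
    [D], so a subset of [D] is a [1,2]-set as soon as it is dominating.  If
    [S <= D] is an inclusion-minimal [1,2]-set, each of its vertices has a
    neighbour outside [S], while each vertex outside [S] has at most two
    neighbours in [S]; hence [#|S| <= 2 (n - #|S|)], and gamma12 is at most
    [2n/3], which settles (1) and (2) together.  In a tree with an internal
    vertex, the internal vertices of [D] already form a [1,2]-set, so
    [gamma12 = n - k] forces [D] to contain all internal vertices.  Each of
    these then has at most two internal neighbours, and a longest path of
    internal vertices contains them all. *)
Require Import Defs.
From HB Require Import structures.
From mathcomp Require Import all_boot all_order all_algebra.
From mathcomp Require Import zify lra.

Set Implicit Arguments.
Unset Strict Implicit.
Unset Printing Implicit Defensive.

Import Order.TTheory GRing.Theory Num.Theory.

Lemma gamma12_le (T : finType) (e : rel T) (S : {set T}) :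
  is_12set e S -> gamma12 e <= #|S|.
Proof.
rewrite /gamma12 => S12.
by case: arg_minnP => [|S0 _]; [exact: is_12setT | apply].
Qed.

Lemma gamma_t12_None (T : finType) (e : rel T) :
  (forall D : {set T}, ~ is_total_12set e D) -> gamma_t12 e = None.
Proof. by rewrite /gamma_t12; case: pickP => // D Dtot /(_ D). Qed.

(** * Subsets of a total [1,2]-set, and the bound of two thirds *)

Section TotalSet.

Variables (T : finType) (e : rel T) (D : {set T}).
Hypotheses (e_sym : symmetric e) (e_irr : irreflexive e).
Hypothesis D_total : is_total_12set e D.

Lemma total_12set_neighbour v : exists2 u, e v u & u \in D.
Proof.
have /forallP/(_ v)/andP[+ _] := D_total.
by case/card_gt0P=> u; rewrite !inE => /andP[]; exists u.
Qed.

Lemma card_nbhd_sub_total v (S : {set T}) :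
  S \subset D -> #|nbhd e v :&: S| <= 2.
Proof.
move=> SD; have /forallP/(_ v)/andP[_] := D_total.
by apply: leq_trans; rewrite subset_leq_card // setIS.
Qed.

Lemma dominating_sub_total_12set (S : {set T}) :
  S \subset D -> (forall v, v \notin S -> exists2 u, e v u & u \in S) ->
  is_12set e S.
Proof.
move=> SD dom; apply/forallP => v; apply/implyP; rewrite inE => /dom[u vu uS].
rewrite card_nbhd_sub_total // andbT; apply/card_gt0P; exists u.
by rewrite !inE vu.
Qed.

(** If all neighbours of [s] were in [S], then [S :\ s] would still dominate: [s] has a neighbour,
    which lies in [S], and no vertex outside [S] is adjacent to [s]. This contradicts minimality. *)
Lemma minimal_12set_outside_neighbour (S : {set T}) s :
  minset (is_12set e) S -> S \subset D -> s \in S ->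
  exists2 u, e s u & u \notin S.
Proof.
case/minsetP=> S12 Smin SD sS.
have [/existsP[u /andP[su uS]]|] := boolP [exists u, e s u && (u \notin S)].
  by exists u.
move/existsPn => inS.
have nbS u : e s u -> u \in S.
  by move=> su; move: (inS u); rewrite su negbK.
suff S'12 : is_12set e (S :\ s).
  by move: sS; rewrite -{1}(Smin _ S'12 (subD1set _ _)) !inE eqxx.
apply: dominating_sub_total_12set => [|v].
  by apply: subset_trans SD; exact: subD1set.
rewrite !inE negb_and negbK => /orP[/eqP ->|vS].
  have [u su _] := total_12set_neighbour s; exists u => //.
  by rewrite !inE nbS // andbT; apply: contraTneq su => ->; rewrite e_irr.
have /forallP/(_ v)/implyP := S12; rewrite inE => /(_ vS)/andP[+ _].
case/card_gt0P=> u; rewrite !inE => /andP[vu uS]; exists u => //.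
rewrite !inE uS andbT; apply: contraNneq vS => us.
by apply: nbS; rewrite -us e_sym.
Qed.

Lemma gamma12_le_two_thirds : 3 * gamma12 e <= 2 * #|T|.
Proof.
have D12 : is_12set e D.
  by apply: dominating_sub_total_12set => // v _; exact: total_12set_neighbour.
have [S Smin SD] := minset_exists D12.
have outS := minimal_12set_outside_neighbour Smin SD.
have leS : #|S| <= 2 * #|~: S|.
  (* Double counting of the edges between [S] and its complement: at least one per vertex of [S], at
     most two per vertex outside. *)
  apply: (@leq_trans (\sum_(s in S) \sum_(u in ~: S) e s u)).
    rewrite -sum1_card; apply: leq_sum => s /outS[u su uS].
    by rewrite (bigD1 u) /= ?inE // su.
  rewrite exchange_big /= mulnC -sum_nat_const; apply: leq_sum => u _.
  apply: leq_trans (card_nbhd_sub_total u SD).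
  rewrite -sum1_card [leqRHS]big_mkcond [leqLHS]big_mkcond.
  apply: leq_sum => s _; rewrite !inE (e_sym s u) andbC.
  by case: (s \in S); case: (e u s).
have [S12 _] := minsetP Smin.
have := gamma12_le S12; have := cardsC S; lia.
Qed.

End TotalSet.

(** * Longest paths inside a vertex set, and chords in acyclic graphs *)

Section InducedPath.

Variables (T : finType) (e : rel T) (A : {set T}).
Hypothesis e_sym : symmetric e.

Definition path_in (p : seq T) : bool := [&& uniq p, sorted e p & all [in A] p].

Lemma longest_path_in :
  exists2 p, path_in p & forall q, path_in q -> size q <= size p.
Proof.
pose P n := [exists t : n.-tuple T, path_in t].
have P0 : exists n, P n by exists 0; apply/existsP; exists [tuple].
have Pmax n : P n -> n <= #|T|.
  case/existsP=> t /andP[/card_uniqP tU _].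
  by rewrite -(size_tuple t) -tU max_card.
case: (ex_maxnP P0 Pmax) => m /existsP[t tP] mmax.
exists t => // q qP; rewrite size_tuple; apply: mmax.
by apply/existsP; exists (in_tuple q).
Qed.

(* If [y] is an end of [p] then [p] extends by [z]; otherwise [z] and the two
   neighbours of [y] on [p] are three neighbours of [y] in [A]. *)
Lemma longest_path_closed p y z :
  (forall v, v \in A -> #|nbhd e v :&: A| <= 2) ->
  path_in p -> (forall q, path_in q -> size q <= size p) ->
  y \in p -> z \in A -> e y z -> z \in p.
Proof.
move=> degA pP pmax yp zA yz; apply/negPn/negP => zp.
have {pmax}ext q : size q = (size p).+1 -> ~ path_in q.
  by move=> sq /pmax; rewrite sq ltnn.
case/splitPr: yp => p1 p2 in pP zp ext.
case/and3P: pP => pU ps pA.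
case/lastP: p1 => [|p1 a] in pU ps pA zp ext.
  apply: (ext (z :: y :: p2)) => //.
  apply/and3P; split; last by rewrite /= zA; move: pA.
  - by rewrite cons_uniq zp; move: pU.
  - by rewrite /= e_sym yz; move: ps.
case: p2 => [|b p2] in pU ps pA zp ext.
  rewrite cats1 in pU ps pA zp ext.
  apply: (ext (rcons (rcons (rcons p1 a) y) z)); first by rewrite size_rcons.
  apply/and3P; split; last by rewrite all_rcons pA andbT.
  - by rewrite rcons_uniq zp.
  - move: ps; case: (rcons p1 a) => [|c s] /=; first by rewrite yz.
    by move=> csy; rewrite rcons_path csy last_rcons.
have yA : y \in A by move/allP: pA; apply; rewrite mem_cat inE eqxx orbT.
have aA : a \in A.
  by move/allP: pA; apply; rewrite mem_cat mem_rcons inE eqxx.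
have bA : b \in A.
  by move/allP: pA; apply; rewrite mem_cat !inE eqxx !orbT.
have ya : e y a.
  move: ps; rewrite cat_rcons e_sym => /cat_sorted2[_] /=.
  by case/andP.
have yb : e y b by move: ps => /cat_sorted2[_] /= /andP[].
have ab : a != b.
  move: pU; rewrite cat_uniq => /and3P[_ /hasPn + _] => /(_ b).
  rewrite !inE eqxx orbT mem_rcons inE negb_or => /(_ isT)/andP[+ _].
  by rewrite eq_sym.
have az : a != z.
  by apply: contraNneq zp => <-; rewrite mem_cat mem_rcons inE eqxx.
have bz : b != z.
  by apply: contraNneq zp => <-; rewrite mem_cat !inE eqxx !orbT.
have : #|[set a; b; z]| <= #|nbhd e y :&: A|.
  apply/subset_leq_card/subsetP => v; rewrite !inE.
  by case/orP=> [/orP[]|] /eqP ->; apply/andP.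
rewrite -setUA cardsU1 cards2 !inE negb_or ab az bz => /leq_trans/(_ (degA y yA)).
by [].
Qed.

(** An edge between positions [i] and [j] closes the segment of [p] between them into a cycle on
    [j - i + 1] vertices; acyclicity makes this number less than 3. *)
Lemma acyclic_chord (x0 : T) p i j :
  is_acyclic e -> uniq p -> sorted e p -> i < j -> j < size p ->
  e (nth x0 p i) (nth x0 p j) = (i.+1 == j).
Proof.
move=> acyc pU ps ij jp; apply/idP/eqP => [eij|ijE]; last first.
  by move/(sortedP x0): ps; rewrite -ijE; apply; rewrite ijE.
pose c := take (j - i).+1 (drop i p).
have sc : size c = (j - i).+1 by rewrite size_takel // size_drop; lia.
have c_path : sorted e c by exact/take_sorted/drop_sorted.
have c0 : nth x0 c 0 = nth x0 p i by rewrite nth_take // nth_drop addn0.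
have cl : nth x0 c (j - i) = nth x0 p j.
  by rewrite nth_take // nth_drop; congr nth; lia.
suff /acyc : ucycle e c by rewrite sc; lia.
apply/andP; split; last exact/take_uniq/drop_uniq.
move: c_path c0 cl; case: (c) sc => [//|x s] [ss] /= xs xi cl.
by rewrite rcons_path xs (last_nth x0) ss cl xi e_sym.
Qed.

Lemma path_induces_path p :
  irreflexive e -> is_acyclic e -> path_in p -> {subset A <= p} ->
  induces_path e A.
Proof.
move=> e_irr acyc /and3P[pU ps /allP pA] Ap.
exists (size p), (tnth (in_tuple p)); split.
- by apply/(tuple_uniqP (in_tuple p)).
- move=> v; split=> [/Ap vp|[i <-]]; last by apply: pA; exact: mem_tnth.
  by have /tnthP[i ->] : v \in in_tuple p by []; exists i.
- move=> i j; have x0 := tnth (in_tuple p) i.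
  rewrite !(tnth_nth x0) /=; case: (ltngtP i j) => [ij|ji|->].
  + by rewrite acyclic_chord //; lia.
  + by rewrite e_sym acyclic_chord //; lia.
  + by rewrite e_irr; lia.
Qed.

End InducedPath.

(** * Leaves of connected graphs, and the path of internal vertices *)

Section Tree.

Variables (T : finType) (e : rel T).
Hypotheses (e_sym : symmetric e) (e_irr : irreflexive e).
Hypothesis e_conn : is_connected e.

Lemma leaf_neighbour_unique v x y :
  v \in leaves e -> e v x -> e v y -> x = y.
Proof.
rewrite inE => /cards1P[w vw] vx vy.
have : x \in nbhd e v by rewrite inE.
have : y \in nbhd e v by rewrite inE.
by rewrite vw !inE => /eqP -> /eqP ->.
Qed.

Lemma connected_closed_set (B : {set T}) x :
  x \in B -> (forall u v, u \in B -> e u v -> v \in B) -> forall v, v \in B.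
Proof.
move=> xB Bcl v; case: e_conn => _ /(_ x v) xv.
have cl : closed e B.
  apply: intro_closed => [|u w uw uB]; last exact: Bcl uB uw.
  by apply: sym_connect_sym.
by rewrite -(closed_connect cl xv).
Qed.

(** Two adjacent leaves form a set closed under adjacency, so by connectedness the graph is a single
    edge. *)
Lemma adjacent_leaves_cover x y :
  x \in leaves e -> y \in leaves e -> e x y -> leaves e = [set: T].
Proof.
move=> xl yl xy; have yx : e y x by rewrite e_sym.
apply/setP => v; rewrite [RHS]in_setT.
have : v \in [set x; y].
  apply: (@connected_closed_set _ x) => [|u w]; first by rewrite !inE eqxx.
  rewrite !inE => /orP[] /eqP -> uw.
    by rewrite (leaf_neighbour_unique xl uw xy) eqxx orbT.
  by rewrite (leaf_neighbour_unique yl uw yx) eqxx.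
by rewrite in_set2 => /orP[] /eqP ->.
Qed.

(** Let [v] lie outside [D :\: leaves e] and let [y] be a neighbour of [v] in [D]. If [y] were a
    leaf, its neighbour in [D] could only be [v]; then [v] would be a leaf too, adjacent to the leaf
    [y]. So [y] is internal and dominates [v]. *)
Lemma nonleaf_total_12set (D : {set T}) :
  is_total_12set e D -> leaves e != [set: T] ->
  is_12set e (D :\: leaves e).
Proof.
move=> Dtot not_all; apply: (dominating_sub_total_12set Dtot).
  exact: subsetDl.
move=> v; have [y vy yD] := total_12set_neighbour Dtot v.
rewrite in_setD negb_and negbK => vND; exists y => //.
rewrite in_setD yD andbT; apply/negP => yl.
have yv : e y v by rewrite e_sym.
have [w yw wD] := total_12set_neighbour Dtot y.
rewrite -(leaf_neighbour_unique yl yv yw) in wD.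
case/orP: vND => [vl|]; last by rewrite wD.
by rewrite (adjacent_leaves_cover vl yl vy) eqxx in not_all.
Qed.

Lemma nonleaves_induce_path :
  is_acyclic e ->
  (forall v, v \notin leaves e -> #|nbhd e v :\: leaves e| <= 2) ->
  induces_path e (~: leaves e).
Proof.
move=> acyc deg2.
have degA v : v \in ~: leaves e -> #|nbhd e v :&: ~: leaves e| <= 2.
  by rewrite -setDE in_setC; exact: deg2.
have [p pP pmax] := longest_path_in e (~: leaves e).
have ext := longest_path_closed e_sym degA pP pmax.
apply: (path_induces_path e_sym e_irr acyc pP) => a aA.
(* The one-vertex path on [a] shows that the longest path is nonempty. *)
have [y yp] : exists y, y \in p.
  have : path_in e (~: leaves e) [:: a] by rewrite /path_in /= aA.
  by move/pmax; case: (p) => [//|y s _]; exists y; rewrite inE eqxx.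
have pl v : v \in p -> v \notin leaves e.
  by case/and3P: pP => _ _ /allP pA /pA; rewrite /= in_setC.
(* The path together with the leaves attached to it is closed under adjacency, hence is the whole
   graph; an internal vertex such as [a] must then lie on [p]. *)
pose B := [set v | (v \in p) || (v \in leaves e) && has (e v) p].
suff : a \in B by move: aA; rewrite in_setC [a \in B]inE => /negbTE ->; rewrite orbF.
apply: (@connected_closed_set _ y) => [|u w]; rewrite ![_ \in B]inE ?yp //.
case/orP=> [up|/andP[ul /hasP[x xp ux]]] uw; last first.
  by rewrite (leaf_neighbour_unique ul uw ux) xp.
have [wl|wl] := boolP (w \in leaves e); last by rewrite (ext u) ?in_setC.
by apply/orP; right; apply/hasP; exists u; rewrite // e_sym.
Qed.

End Tree.

Theorem theorem3p1 (T : finType) (e : rel T) (n : nat)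
    (e_sym : symmetric e) (e_irr : irreflexive e)
    (e_conn : is_connected e) (order_n : #|T| = n) :
  [/\ (3 <= n -> (4 * n%:R / 5 < (gamma12 e)%:R :> rat)%R ->
        gamma_t12 e = None),
      (5 <= n -> 2 <= min_degree e ->
        (2 * n%:R / 3 < (gamma12 e)%:R :> rat)%R ->
        gamma_t12 e = None)
    & (forall k : nat, is_tree e -> #|leaves e| = k ->
        gamma12 e = n - k ->
        ~ is_caterpillar e -> gamma_t12 e = None)].
Proof.
have two_thirds (D : {set T}) : is_total_12set e D ->
    ((gamma12 e)%:R * 3 <= n%:R * 2 :> rat)%R.
  move=> Dtot; rewrite -!natrM ler_nat -order_n mulnC [leqRHS]mulnC.
  exact: gamma12_le_two_thirds e_sym e_irr Dtot.
(* This gives 2n/3 <= 4n/5, so that [two_thirds] contradicts the bound in (1) as well as that in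
   (2). *)
have n_ge0 : (0 <= n%:R :> rat)%R by exact: ler0n.
split=> [_ gt|_ _ gt|k [_ acyc] leaves_k gammaE not_cat];
  apply: gamma_t12_None => D Dtot.
- by have := two_thirds D Dtot; lra.
- by have := two_thirds D Dtot; lra.
- apply: not_cat; split => //; apply: nonleaves_induce_path => // v vl.
  have not_all : leaves e != [set: T].
    by apply: contraNneq vl => ->; rewrite inE.
  have /gamma12_le := nonleaf_total_12set e_sym e_conn Dtot not_all.
  have := cardsC (leaves e); rewrite leaves_k order_n gammaE => cardC le_nk.
  have sub : D :\: leaves e \subset ~: leaves e.
    by rewrite setDE subsetIr.
  (* There are [n - k] internal vertices, and [le_nk] says that at least that many lie in [D]; hence
     all of them do. *)
  have /eqP DE : D :\: leaves e == ~: leaves e by rewrite eqEcard sub; lia.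
  rewrite setDE; apply: (card_nbhd_sub_total Dtot).
  by rewrite -DE subsetDl.
Qed.
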